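(* Let $G_1$ and $G_2$ be graphs with $m$ and $n$ vertices respectively such that the pair $(G_1,G_2)$ is niche-realizable. Then $\alpha(G_1)\le 2$ and $\alpha(G_2)\le 2$, where $\alpha$ denotes the independence number.
   Context: All graphs are simple. The niche graph of a digraph $D$ is the graph with vertex set $V(D)$ in which distinct $u,v$ are adjacent iff there is a vertex $w$ with $(u,w),(v,w)\in A(D)$, or with $(w,u),(w,v)\in A(D)$. The pair $(G_1,G_2)$, with $|V(G_1)|=m$, $|V(G_2)|=n$, is niche-realizable if the disjoint union of $G_1$ and $G_2$ is the niche graph of an orientation of the complete bipartite graph $K_{m,n}$ with bipartition $(V(G_1),V(G_2))$. *)

(* Defs.v *)
From mathcomp Require Import all_boot.

Set Implicit Arguments.
Unset Strict Implicit.
Unset Printing Implicit Defensive.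

Record sgraph (V : finType) := SGraph {
  adj :> rel V;
  adj_sym : symmetric adj;
  adj_irr : irreflexive adj }.

(* A digraph on V is a relation D : rel V; its arcs are the (u, v) with D u v. *)

Section NicheGraph.
Variables (V : finType) (D : rel V).

Definition niche_adj : rel V := fun u v =>
  (u != v) && [exists w, (D u w && D v w) || (D w u && D w v)].

Lemma niche_adj_sym : symmetric niche_adj.
Proof.
move=> u v; rewrite /niche_adj eq_sym; congr (_ && _).
by apply: eq_existsb => w; rewrite andbC [D w u && _]andbC.
Qed.

Lemma niche_adj_irr : irreflexive niche_adj.
Proof. by move=> u; rewrite /niche_adj eqxx. Qed.

Definition niche_graph : sgraph V := SGraph niche_adj_sym niche_adj_irr.

End NicheGraph.

Section DisjointUnion.
Variables (V1 V2 : finType) (G1 : sgraph V1) (G2 : sgraph V2).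

Definition union_adj : rel (V1 + V2) := fun x y =>
  match x, y with
  | inl u, inl v => G1 u v
  | inr u, inr v => G2 u v
  | _, _ => false
  end.

Lemma union_adj_sym : symmetric union_adj.
Proof. by case=> u [] v //=; apply: adj_sym. Qed.

Lemma union_adj_irr : irreflexive union_adj.
Proof. by case=> u /=; apply: adj_irr. Qed.

Definition disjoint_union : sgraph (V1 + V2)%type :=
  SGraph union_adj_sym union_adj_irr.

End DisjointUnion.

Section CompleteBipartite.
Variables (V1 V2 : finType).

Definition complete_bipartite_adj : rel (V1 + V2) := fun x y =>
  match x, y with
  | inl _, inr _ | inr _, inl _ => true
  | _, _ => false
  end.

Lemma complete_bipartite_adj_sym : symmetric complete_bipartite_adj.
Proof. by case=> u []. Qed.

Lemma complete_bipartite_adj_irr : irreflexive complete_bipartite_adj.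
Proof. by case. Qed.

Definition complete_bipartite : sgraph (V1 + V2)%type :=
  SGraph complete_bipartite_adj_sym complete_bipartite_adj_irr.

End CompleteBipartite.

(* Arcs only along edges, and exactly one of (u, v), (v, u) for each edge. *)
Definition orientation (V : finType) (G : sgraph V) (D : rel V) : Prop :=
  (forall u v, D u v -> G u v) /\ (forall u v, G u v -> D u v (+) D v u).

(* The vertex set V1 + V2 is common to both sides, so "is the niche graph" is
   equality of adjacency relations rather than isomorphism. *)
Definition niche_realizable (V1 V2 : finType)
    (G1 : sgraph V1) (G2 : sgraph V2) : Prop :=
  exists2 D : rel (V1 + V2),
    orientation (complete_bipartite V1 V2) D &
    disjoint_union G1 G2 =2 niche_graph D.

Definition independent (V : finType) (G : sgraph V) (S : {set V}) : bool :=
  [forall u in S, forall v in S, ~~ G u v].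

Definition independence_number (V : finType) (G : sgraph V) : nat :=
  \max_(S : {set V} | independent G S) #|S|.

(* Main.v *)
(** A vertex [w] of the opposite side is joined by an arc to every vertex [u]
    of a given side, and two vertices whose arcs with [w] point the same way
    are adjacent in the niche graph. The direction of this arc is therefore
    injective on an independent set, which thus has at most two elements. *)
Require Import Defs.
From mathcomp Require Import all_boot.

(** The fibres of [f] are cliques covering [G], and an independent set meets each clique at most
    once. *)
Lemma independence_number_le_card (V C : finType) (G : sgraph V) (f : V -> C) :
  (forall u v, u != v -> f u = f v -> G u v) -> independence_number G <= #|C|.
Proof.
move=> adjG; apply/bigmax_leqP => S indepS.
have f_inj : {in S &, injective f}.
  move=> u v uS vS fuv; apply/eqP; apply: contraT => neq_uv.
  move/forall_inP: indepS => /(_ u uS)/forall_inP/(_ v vS).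
  by rewrite (adjG u v neq_uv fuv).
by rewrite -(card_in_imset f_inj) max_card.
Qed.

(** If [D v w] holds, [w] is a common out-neighbour; otherwise exclusivity reverses both arcs and
    [w] is a common in-neighbour. *)
Lemma niche_adj_same_direction (V : finType) (D : rel V) (u v w : V) :
  u != v -> D u w (+) D w u -> D v w (+) D w v -> D u w = D v w ->
  niche_adj D u v.
Proof.
move=> neq_uv uw vw eq_uv; rewrite /niche_adj neq_uv; apply/existsP; exists w.
by move: uw vw; rewrite eq_uv; case: (D v w) => /= [|-> ->].
Qed.

Theorem theorem2p7 (m n : nat) (V1 V2 : finType)
    (G1 : sgraph V1) (G2 : sgraph V2)
    (m_gt0 : 0 < m) (n_gt0 : 0 < n)
    (cardG1 : #|V1| = m) (cardG2 : #|V2| = n)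
    (G12 : niche_realizable G1 G2) :
  independence_number G1 <= 2 /\ independence_number G2 <= 2.
Proof.
case: G12 => D [_ orientD] nicheD.
have /card_gt0P[w1 _] : 0 < #|V1| by rewrite cardG1.
have /card_gt0P[w2 _] : 0 < #|V2| by rewrite cardG2.
(* The bound 2 counts the two possible directions of an arc, which serve as the colours in
   [bool]. *)
rewrite -card_bool; split.
- apply: (@independence_number_le_card _ _ _ (fun u => D (inl u) (inr w2))).
  move=> u v neq_uv eq_uv; have /= -> := nicheD (inl u) (inl v).
  by apply: (@niche_adj_same_direction _ _ _ _ (inr w2)) => //; apply: orientD.
- apply: (@independence_number_le_card _ _ _ (fun u => D (inr u) (inl w1))).
  move=> u v neq_uv eq_uv; have /= -> := nicheD (inr u) (inr v).
  by apply: (@niche_adj_same_direction _ _ _ _ (inl w1)) => //; apply: orientD.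
Qed.
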